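(* For $m_1\in[m]$ let $$\Theta_{\mathrm L}(m_1)=\max_{\mathbf B\in\mathcal B_{m_1}}\ \min_{\mathbf x\in\mathcal X}\ \max_{\mathbb P_{\mathrm r}\in\mathcal D_{\mathrm L}}\ \mathbb E_{\mathbb P_{\mathrm r}}\left[f\left(\mathbf x,\mathbf U\boldsymbol\Lambda^{1/2}\mathbf B\boldsymbol\xi_{\mathrm r}+\boldsymbol\mu\right)\right],$$ and let $$\Theta_{\mathrm M}(m)=\min_{\mathbf x\in\mathcal X}\ \max_{\mathbb P_{\mathrm I}\in\mathcal D_{\mathrm M}}\ \mathbb E_{\mathbb P_{\mathrm I}}\left[f\left(\mathbf x,\mathbf U\boldsymbol\Lambda^{1/2}\boldsymbol\xi_{\mathrm I}+\boldsymbol\mu\right)\right],$$ where the data and the sets $\mathcal B_{m_1},\mathcal D_{\mathrm L},\mathcal D_{\mathrm M}$ are as in the context. Then: (i) $\Theta_{\mathrm L}(m_1)\le\Theta_{\mathrm M}(m)$ for any $m_1\le m$; (ii) $\Theta_{\mathrm L}(m_1)\le\Theta_{\mathrm L}(m_2)$ for any $m_1<m_2\le m$; (iii) $\Theta_{\mathrm L}(m)=\Theta_{\mathrm M}(m)$.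
   Context: Setting. $[N]=\{1,\dots,N\}$; $m,n,l,K$ are positive integers; $\gamma_1\ge 0$, $\gamma_2\ge 1$; $\boldsymbol\mu\in\mathbb R^m$; $\boldsymbol\Sigma\in\mathbb R^{m\times m}$ is symmetric positive definite with eigenvalue decomposition $\boldsymbol\Sigma=\mathbf U\boldsymbol\Lambda\mathbf U^\top$, $\mathbf U$ orthogonal, $\boldsymbol\Lambda$ diagonal with nonincreasing diagonal entries. $\mathcal X\subseteq\mathbb R^n$. The support set is $\mathcal S=\{\boldsymbol\xi\in\mathbb R^m: \mathbf A\boldsymbol\xi\le\mathbf b\}$ with $\mathbf A\in\mathbb R^{l\times m}$, $\mathbf b\in\mathbb R^l$, and has at least one interior point. The function $f$ is piecewise linear convex in $\boldsymbol\xi$: $f(\mathbf x,\boldsymbol\xi)=\max_{k\in[K]}\{y_k^0(\mathbf x)+y_k(\mathbf x)^\top\boldsymbol\xi\}$ with $y_k^0(\mathbf x)\in\mathbb R$ and $y_k(\mathbf x)\in\mathbb R^m$ affine in $\mathbf x$. $\preceq$ is the positive semidefinite (Loewner) order and $\mathbf I_d$ the $d\times d$ identity. $\mathcal B_{m_1}=\{\mathbf B\in\mathbb R^{m\times m_1}:\mathbf B^\top\mathbf B=\mathbf I_{m_1}\}$. $\mathcal D_{\mathrm M}$ is the set of probability distributions $\mathbb P_{\mathrm I}$ of a random vector $\boldsymbol\xi_{\mathrm I}\in\mathbb R^m$ with $\mathbb P_{\mathrm I}(\boldsymbol\xi_{\mathrm I}\in\mathcal S_{\mathrm I})=1$, $\mathbb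 E_{\mathbb P_{\mathrm I}}[\boldsymbol\xi_{\mathrm I}^\top]\,\mathbb E_{\mathbb P_{\mathrm I}}[\boldsymbol\xi_{\mathrm I}]\le\gamma_1$, $\mathbb E_{\mathbb P_{\mathrm I}}[\boldsymbol\xi_{\mathrm I}\boldsymbol\xi_{\mathrm I}^\top]\preceq\gamma_2\mathbf I_m$, where $\mathcal S_{\mathrm I}=\{\boldsymbol\xi_{\mathrm I}\in\mathbb R^m:\mathbf U\boldsymbol\Lambda^{1/2}\boldsymbol\xi_{\mathrm I}+\boldsymbol\mu\in\mathcal S\}$. For given $\mathbf B\in\mathcal B_{m_1}$, $\mathcal D_{\mathrm L}$ is the set of probability distributions $\mathbb P_{\mathrm r}$ of a random vector $\boldsymbol\xi_{\mathrm r}\in\mathbb R^{m_1}$ with $\mathbb P_{\mathrm r}(\boldsymbol\xi_{\mathrm r}\in\mathcal S_{\mathrm r})=1$, $\mathbb E_{\mathbb P_{\mathrm r}}[\boldsymbol\xi_{\mathrm r}^\top]\,\mathbb E_{\mathbb P_{\mathrm r}}[\boldsymbol\xi_{\mathrm r}]\le\gamma_1$, $\mathbb E_{\mathbb P_{\mathrm r}}[\boldsymbol\xi_{\mathrm r}\boldsymbol\xi_{\mathrm r}^\top]\preceq\gamma_2\mathbf I_{m_1}$, where $\mathcal S_{\mathrm r}=\{\boldsymbol\xi_{\mathrm r}\in\mathbb R^{m_1}:\mathbf U\boldsymbol\Lambda^{1/2}\mathbf B\boldsymbol\xi_{\mathrm r}+\boldsymbol\mu\in\mathcal S\}$. The value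 of a min (max) problem means its optimal value, i.e. the infimum (supremum) in the extended reals. *)

(* Defs.v *)
From HB Require Import structures.
From mathcomp Require Import all_boot all_order all_algebra.
From mathcomp Require Import all_classical all_reals all_analysis.

Set Implicit Arguments.
Unset Strict Implicit.
Unset Printing Implicit Defensive.

Import Order.TTheory GRing.Theory Num.Theory.
Import numFieldNormedType.Exports.

Local Open Scope classical_set_scope.
Local Open Scope ring_scope.

Section Matrices.
Context {R : realType}.

Definition posdefmx d (M : 'M[R]_d) : Prop :=
  M^T = M /\ forall v : 'cV[R]_d, v != 0 -> 0 < (v^T *m M *m v) 0 0.

Definition psdmx d (M : 'M[R]_d) : Prop :=
  M^T = M /\ forall v : 'cV[R]_d, 0 <= (v^T *m M *m v) 0 0.

Definition loewner_le d (M N : 'M[R]_d) : Prop := psdmx (N - M).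

Definition orthonormal_cols m d : set 'M[R]_(m, d) :=
  [set B | B^T *m B = 1%:M].

Definition polyhedron l m (A : 'M[R]_(l, m)) (b : 'cV[R]_l) : set 'cV[R]_m :=
  [set xi | forall i, (A *m xi) i 0 <= b i 0].

Definition is_affine (V W : lmodType R) (h : V -> W) : Prop :=
  exists (L : {linear V -> W}) (c : W), forall x, h x = L x + c.

(* There are K.+1 pieces, so that the maximum is over a nonempty index set;
   the unit of the iterated maximum is the piece of index 0. *)
Definition max_affine n m K (y0 : 'I_K.+1 -> 'cV[R]_n -> R)
    (y : 'I_K.+1 -> 'cV[R]_n -> 'cV[R]_m) (x : 'cV[R]_n) (xi : 'cV[R]_m) : R :=
  let piece k := y0 k x + ((y k x)^T *m xi) 0 0 in
  \big[Num.max/piece ord0]_(k < K.+1) piece k.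

End Matrices.

(* R^d with its Borel sigma-algebra; probability measures on it are the
   distributions of d-dimensional random vectors. *)
Notation borel_cV R d := (g_sigma_algebraType (@open 'cV[R]_d)).

Section Ambiguity.
Context {R : realType}.

Section Moments.
Variables (d : nat) (P : probability (borel_cV R d) R).

Definition mean : 'cV[R]_d :=
  \col_i fine 'E_P[fun xi : 'cV[R]_d => xi i 0].

Definition second_moment : 'M[R]_d :=
  \matrix_(i, j) fine 'E_P[fun xi : 'cV[R]_d => xi i 0 * xi j 0].

(* [fine] sends infinite or undefined expectations to junk real values, so the
   existence of the moments has to be required separately. *)
Definition has_moments : Prop :=
  (forall i, P.-integrable setT (fun xi : 'cV[R]_d => (xi i 0)%:E)) /\
  (forall i j,
     P.-integrable setT (fun xi : 'cV[R]_d => (xi i 0 * xi j 0)%:E)).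

End Moments.

Definition ambiguity (gamma1 gamma2 : R) d (S : set 'cV[R]_d) :
    set (probability (borel_cV R d) R) :=
  [set P : probability (borel_cV R d) R |
           [/\ P S = 1%E, has_moments P,
               ((mean P)^T *m mean P) 0 0 <= gamma1 &
               loewner_le (second_moment P) (gamma2%:M)]].

Variables (n m : nat) (gamma1 gamma2 : R).
Variables (mu : 'cV[R]_m) (U : 'M[R]_m) (lam : 'rV[R]_m).
Variables (S : set 'cV[R]_m) (X : set 'cV[R]_n).
Variable f : 'cV[R]_n -> 'cV[R]_m -> R.

(* U Lambda^(1/2), where Lambda = diag_mx lam *)
Definition scale_mx : 'M[R]_m := U *m diag_mx (map_mx Num.sqrt lam).

Definition full_map (xi : 'cV[R]_m) : 'cV[R]_m := scale_mx *m xi + mu.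

Definition reduced_map d (B : 'M[R]_(m, d)) (xi : 'cV[R]_d) : 'cV[R]_m :=
  scale_mx *m B *m xi + mu.

Definition DM : set (probability (borel_cV R m) R) :=
  ambiguity gamma1 gamma2 (full_map @^-1` S).

Definition DL d (B : 'M[R]_(m, d)) : set (probability (borel_cV R d) R) :=
  ambiguity gamma1 gamma2 (reduced_map B @^-1` S).

Definition ThetaM : \bar R :=
  ereal_inf [set ereal_sup [set ('E_P[fun xi : 'cV[R]_m => f x (full_map xi)])%E
                           | P in DM]
            | x in X].

Definition ThetaL (d : nat) : \bar R :=
  ereal_sup
    [set ereal_inf
      [set ereal_sup
        [set ('E_P[fun xi : 'cV[R]_d => f x (reduced_map B xi)])%E | P in DL B]
      | x in X]
    | B in @orthonormal_cols R m d].

End Ambiguity.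

(* Main.v *)
Require Import Defs.
From HB Require Import structures.
From mathcomp Require Import all_boot all_order all_algebra.
From mathcomp Require Import all_classical all_reals all_analysis.
From mathcomp Require Import measurable_realfun.

Set Implicit Arguments.
Unset Strict Implicit.
Unset Printing Implicit Defensive.

Import Order.TTheory GRing.Theory Num.Theory.
Import numFieldNormedType.Exports.

Local Open Scope classical_set_scope.
Local Open Scope ring_scope.

(** Write [C] for a matrix with orthonormal columns.  The theorem rests on one
comparison: if [B1 = B2 *m C], then the worst-case value attached to [B1] is at
most the one attached to [B2] ([reduced_value_mulmx]).  Indeed a distribution
[P] that is feasible for [B1] can be transported along [xi |-> C xi].  The
image is feasible for [B2]:
- it is carried by the right set, because both random vectors are sent to the
  same point of R^m by the maps that [B1] and [B2] define;
- its mean is [C] times the old mean, and [C] preserves norms;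
- its second moment is [C M C^T], where [M] is the old one, and
  [gamma2 I - C M C^T = C (gamma2 I - M) C^T + gamma2 (I - C C^T)] is a sum of
  two positive semidefinite matrices, as [I - C C^T] is an orthogonal projector.
The objective does not change either, for every decision [x].  Thus the set of
attainable expectations only grows from [B1] to [B2], and so do its supremum
and then the infimum over [x].

The full problem is the reduced one for [B2 = I].  Taking [C = B] bounds every
reduced value by the full one; conversely [I] is an admissible [B] in dimension
m, which gives equality there.  For monotonicity in the dimension, an
orthonormal family of m1 columns extends to one of m2 columns
([orthonormal_cols_extension]), hence [B = B' *m C], where [C] selects the
original columns of [B']. *)

(** * Matrices with orthonormal columns *)

Section OrthonormalColumns.
Context {R : realType}.

Lemma colsqr_ge0 m (v : 'cV[R]_m) : 0 <= (v^T *m v) 0 0.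
Proof.
by rewrite mxE sumr_ge0 // => i _; rewrite mxE -expr2 sqr_ge0.
Qed.

Lemma colsqr_gt0 m (v : 'cV[R]_m) : v != 0 -> 0 < (v^T *m v) 0 0.
Proof.
move=> v0; rewrite lt_def colsqr_ge0 andbT.
apply: contra_neq v0; rewrite mxE => /eqP; rewrite psumr_eq0 => [/allP v0|i _].
  apply/colP => i; apply/eqP; have := v0 i (mem_index_enum i).
  by rewrite !mxE mulf_eq0 orbb.
by rewrite mxE -expr2 sqr_ge0.
Qed.

(** The kernel of [B^T] is nonzero by a dimension count; [u] is a normalised
element of it. *)
Lemma orthonormal_cols_unit m d (B : 'M[R]_(m, d)) : (d < m)%N ->
  exists u : 'cV[R]_m, u^T *m u = 1%:M /\ B^T *m u = 0.
Proof.
move=> dm.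
have : kermx B != 0.
  rewrite -mxrank_eq0 mxrank_ker subn_eq0 -ltnNge.
  exact: leq_ltn_trans (rank_leq_col _) dm.
case/rowV0Pn => v /sub_kermxP vB v0.
have w0 : v^T != 0 by rewrite -[0]trmx0 (inj_eq trmx_inj).
have s0 := colsqr_gt0 w0; set s := (_ *m _) 0 0 in s0.
exists ((Num.sqrt s)^-1 *: v^T); split.
  rewrite [(_ *: _)^T]linearZ/= -scalemxAl -scalemxAr scalerA.
  rewrite [_ *m _]mx11_scalar -/s.
  rewrite scale_scalar_mx -invfM -expr2 sqr_sqrtr ?ltW//.
  by rewrite mulVf ?gt_eqF.
by rewrite -scalemxAr -trmx_mul vB trmx0 scaler0.
Qed.

(** Columns are added one at a time.  Recording the extension as a
factorisation [B = B' *m C], rather than as a block decomposition of [B'], is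
what the transport of distributions needs, and it avoids casts between
dimensions. *)
Lemma orthonormal_cols_extension m d e (B : 'M[R]_(m, d)) :
  orthonormal_cols B -> (d <= e <= m)%N ->
  exists (B' : 'M[R]_(m, e)) (C : 'M[R]_(e, d)),
    [/\ orthonormal_cols B', orthonormal_cols C & B = B' *m C].
Proof.
move=> oB /andP[]; elim: e => [|e IHe].
  rewrite leqn0 => /eqP d0 _; subst d; exists B, 1%:M.
  by split; rewrite /orthonormal_cols/= ?trmx1 ?mulmx1.
rewrite leq_eqVlt => /orP[/eqP de|de] em.
  subst d; exists B, 1%:M.
  by split; rewrite /orthonormal_cols/= ?trmx1 ?mulmx1.
have [B' [C [oB' oC BC]]] := IHe de (ltnW em).
have [u [uu B'u]] := orthonormal_cols_unit B' em.
(* The new column comes first, so that the dimension [1 + e] is [e.+1] by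
   computation. *)
have oB'' : (row_mx u B')^T *m row_mx u B' = 1%:M.
  rewrite tr_row_mx mul_col_row uu oB' B'u.
  by rewrite -[u^T *m B']trmxK trmx_mul trmxK B'u trmx0 -scalar_mx_block.
have oC' : (col_mx 0 C : 'M[R]_(1 + e, d)%N)^T *m col_mx 0 C = 1%:M.
  by rewrite tr_col_mx mul_row_col mulmx0 add0r oC.
have BC' : B = row_mx u B' *m col_mx 0 C by rewrite mul_row_col mulmx0 add0r.
by exists (row_mx u B' : 'M[R]_(m, 1 + e)%N), (col_mx (0 : 'rV_d) C).
Qed.

Lemma psdmx_conj p d (C : 'M[R]_(p, d)) (N : 'M[R]_d) :
  psdmx N -> psdmx (C *m N *m C^T).
Proof.
move=> [symN posN]; split=> [|v].
  by rewrite !trmx_mul trmxK symN mulmxA.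
by have := posN (C^T *m v); rewrite trmx_mul trmxK !mulmxA.
Qed.

(** [1%:M - C *m C^T] is the orthogonal projector [Q] onto the complement of
the column space of [C], and [Q = Q^T *m Q]. *)
Lemma psdmx_orth_proj_compl p d (C : 'M[R]_(p, d)) : orthonormal_cols C ->
  psdmx (1%:M - C *m C^T).
Proof.
move=> oC; set Q := _ - _.
have symQ : Q^T = Q by rewrite /Q linearB/= trmx1 trmx_mul trmxK.
have QC : Q *m C = 0.
  by rewrite /Q mulmxBl mul1mx -mulmxA oC mulmx1 subrr.
have idQ : Q *m Q = Q by rewrite {2}/Q mulmxBr mulmx1 mulmxA QC mul0mx subr0.
split=> // v; rewrite -idQ -{1}symQ -mulmxA -mulmxA mulmxA -trmx_mul.
exact: colsqr_ge0.
Qed.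

(** The upper bound [g%:M] survives the change of dimension thanks to
[g I - C M C^T = C (g I - M) C^T + g (I - C C^T)]; this is where the sign of
[g] matters. *)
Lemma loewner_le_conj p d (C : 'M[R]_(p, d)) (M : 'M[R]_d) (g : R) :
  orthonormal_cols C -> 0 <= g -> loewner_le M g%:M ->
  loewner_le (C *m M *m C^T) g%:M.
Proof.
move=> oC g0 Mg; have [symN posN] := psdmx_conj C Mg.
have [symQ posQ] := psdmx_orth_proj_compl oC.
have -> : loewner_le (C *m M *m C^T) g%:M =
    psdmx (C *m (g%:M - M) *m C^T + g *: (1%:M - C *m C^T)).
  congr psdmx; rewrite mulmxBr mulmxBl mul_mx_scalar -scalemxAl scalerBr.
  by rewrite scalemx1 [RHS]addrC addrA subrK.
split=> [|v]; first by rewrite linearD/= linearZ/= symN symQ.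
rewrite mulmxDr mulmxDl mxE addr_ge0 //.
by rewrite -scalemxAr -scalemxAl mxE mulr_ge0.
Qed.

End OrthonormalColumns.

(** * Borel functions on spaces of column vectors *)

Section BorelVectors.
Context {R : realType}.

(** The topology of matrices is the product topology, so continuity can be
checked entry by entry. *)
Lemma mulmx_continuous p d (C : 'M[R]_(p, d)) :
  continuous (fun v : 'cV[R]_d => C *m v).
Proof.
have cC i j : continuous (fun w : 'cV[R]_d => (C *m w) i j).
  under eq_fun do rewrite mxE.
  apply: continuous_big => [|k _ v]; first exact: add_continuous.
  apply: (@continuous_comp _ _ _ (fun w : 'cV[R]_d => w k j)).
    exact: coord_continuous.
  exact: mulrl_continuous.
move=> v A [E nE EA].
suff : \forall w \near v, forall i j, E i j ((C *m w) i j).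
  by apply: filterS => w Ew; exact: EA.
apply: (@filter_forall _ _
  (fun i w => forall j, E i j ((C *m w) i j)) (nbhs v) _) => i.
apply: (@filter_forall _ _ (fun j w => E i j ((C *m w) i j)) (nbhs v) _) => j.
exact: cC (nE i j).
Qed.

Lemma continuous_borel_measurable d e (g : 'cV[R]_d -> 'cV[R]_e) :
  continuous g -> measurable_fun setT (g : borel_cV R d -> borel_cV R e).
Proof.
move=> /continuousP cg.
apply: (measurability (@open 'cV[R]_e : set (set (borel_cV R e)))) => //.
by move=> _ [V oV <-]; apply: sub_sigma_algebra; rewrite setTI; exact: cg.
Qed.

Lemma continuous_borel_measurable_real (T : ptopologicalType) (g : T -> R) :
  continuous g -> measurable_fun setT (g : g_sigma_algebraType (@open T) -> R).
Proof.
move=> /continuousP cg; apply: (measurability _ (RGenOpens.measurableE R)).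
move=> _ [_ [a [b ->]] <-]; apply: sub_sigma_algebra; rewrite setTI.
exact/cg/interval_open.
Qed.

Lemma measurable_coord d (i : 'I_d) :
  measurable_fun setT (fun xi : borel_cV R d => (xi : 'cV[R]_d) i 0).
Proof.
apply: (@continuous_borel_measurable_real 'cV[R]_d (fun xi => xi i 0)).
exact: coord_continuous.
Qed.

Lemma measurable_coordM d (i j : 'I_d) :
  measurable_fun setT
    (fun xi : borel_cV R d => (xi : 'cV[R]_d) i 0 * (xi : 'cV[R]_d) j 0).
Proof. by apply: measurable_funM; exact: measurable_coord. Qed.

Lemma measurable_max_affine n m K (y0 : 'I_K.+1 -> 'cV[R]_n -> R)
    (y : 'I_K.+1 -> 'cV[R]_n -> 'cV[R]_m) (x : 'cV[R]_n) :
  measurable_fun setT (max_affine y0 y x : borel_cV R m -> R).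
Proof.
pose piece k (xi : borel_cV R m) : R := y0 k x + ((y k x)^T *m xi) 0 0.
have mpiece k : measurable_fun setT (piece k).
  apply: measurable_funD => //.
  apply: (@continuous_borel_measurable_real _
    (fun xi : 'cV[R]_m => ((y k x)^T *m xi) 0 0)) => xi.
  apply: (@continuous_comp _ _ _ (fun xi : 'cV[R]_m => (y k x)^T *m xi)
    (fun M : 'cV[R]_1 => M 0 0)); last exact: coord_continuous.
  exact: mulmx_continuous.
rewrite /max_affine; elim: (index_enum _) => [|k r IHr].
  by under eq_fun do rewrite big_nil; exact: (mpiece ord0).
under eq_fun do rewrite big_cons.
exact: (measurable_maxr (mpiece k) IHr).
Qed.

(** * Integration against an image distribution *)

(** Left multiplication by [C] is named so that it can carry a structure of
measurable function between the Borel spaces. *)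
Definition mulmx_borel p d (C : 'M[R]_(p, d)) : borel_cV R d -> borel_cV R p :=
  fun xi => C *m xi.

HB.instance Definition _ p d (C : 'M[R]_(p, d)) :=
  isMeasurableFun.Build _ _ _ _ (mulmx_borel C)
    (continuous_borel_measurable (@mulmx_continuous p d C)).

(** Measurability of [g] suffices, because the integral is the difference of
those of the positive and negative parts; integrability, under which
[integral_distribution] is stated, would force a growth estimate on the
function whose expectation is transported. *)
Lemma expectation_distribution d1 d2 (T1 : measurableType d1)
    (T2 : measurableType d2) (P : probability T1 R) (phi : {mfun T1 >-> T2})
    (g : T2 -> R) :
  measurable_fun setT g ->
  ('E_(distribution P phi)[g] = 'E_P[fun x => g (phi x)])%E.
Proof.
move=> mg; rewrite unlock [LHS]integralE [RHS]integralE.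
have mEg : measurable_fun setT (EFin \o g) by exact/measurable_EFinP.
rewrite (ge0_integral_distribution _ (measurable_funepos mEg))//
  (ge0_integral_distribution _ (measurable_funeneg mEg))//.
congr (_ - _)%E; apply: eq_integral => x _; first by rewrite -funepos_comp.
by rewrite -funeneg_comp.
Qed.

Lemma integrable_distribution d1 d2 (T1 : measurableType d1)
    (T2 : measurableType d2) (P : probability T1 R) (phi : {mfun T1 >-> T2})
    (g : T2 -> R) :
  measurable_fun setT g ->
  P.-integrable setT (fun x => (g (phi x))%:E) ->
  (distribution P phi).-integrable setT (fun x => (g x)%:E).
Proof.
move=> mg ig; apply: integrable_pushforward => //; exact/measurable_EFinP.
Qed.

Lemma integrable_linear_comb d1 (T : measurableType d1)
    (P : probability T R) (I : finType) (c : I -> R) (g : I -> T -> R) :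
  (forall i, P.-integrable setT (fun x => (g i x)%:E)) ->
  P.-integrable setT (fun x => (\sum_i c i * g i x)%:E).
Proof.
move=> ig; under eq_fun do rewrite -sumEFin.
apply: integrable_sum => // i _; under eq_fun do rewrite EFinM.
exact: integrableZl.
Qed.

Lemma fine_expectation_linear_comb d1 (T : measurableType d1)
    (P : probability T R) (I : finType) (c : I -> R) (g : I -> T -> R) :
  (forall i, P.-integrable setT (fun x => (g i x)%:E)) ->
  fine ('E_P[fun x => (\sum_i c i * g i x)%R])%E =
  \sum_i c i * fine ('E_P[g i])%E.
Proof.
move=> ig; rewrite unlock; under eq_integral do rewrite -sumEFin.
have icg i : P.-integrable setT (fun x => (c i * g i x)%:E).
  by under eq_fun do rewrite EFinM; exact: integrableZl.
rewrite integral_sum// -sum_fine => [|i _]; last exact: integrable_fin_num.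
apply: eq_bigr => i _; under eq_integral do rewrite EFinM.
by rewrite integralZl// fineM//; exact: integrable_fin_num.
Qed.

End BorelVectors.

(** * Moments of the image of a distribution under a matrix *)

Section ImageMoments.
Context {R : realType}.
Variables (p d : nat) (C : 'M[R]_(p, d)) (P : probability (borel_cV R d) R).
Hypothesis momP : has_moments P.

Let P' : probability (borel_cV R p) R := distribution P (mulmx_borel C).

Let coordE (xi : 'cV[R]_d) i : (C *m xi) i 0 = \sum_k C i k * xi k 0.
Proof. by rewrite mxE. Qed.

Let coord2E (xi : 'cV[R]_d) i j : (C *m xi) i 0 * (C *m xi) j 0 =
  \sum_kl (C i kl.1 * C j kl.2) * (xi kl.1 0 * xi kl.2 0).
Proof.
rewrite !mxE big_distrlr/= pair_big/=.
by apply: eq_bigr => kl _; rewrite mulrACA.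
Qed.

Let coordM (kl : 'I_d * 'I_d) (xi : borel_cV R d) : R :=
  (xi : 'cV[R]_d) kl.1 0 * (xi : 'cV[R]_d) kl.2 0.

Lemma has_moments_mulmx : has_moments P'.
Proof.
have [m1 m2] := momP; split=> [i|i j].
  apply: integrable_distribution; first exact: measurable_coord.
  rewrite /mulmx_borel/=; under eq_fun do rewrite coordE.
  exact: integrable_linear_comb.
apply: (integrable_distribution (measurable_coordM i j)).
rewrite /mulmx_borel/=; under eq_fun do rewrite coord2E.
apply: (integrable_linear_comb _ (g := coordM)) => kl; exact: m2.
Qed.

Lemma mean_mulmx : mean P' = C *m mean P.
Proof.
apply/colP => i; rewrite !mxE expectation_distribution; last first.
  exact: measurable_coord.
rewrite /mulmx_borel/=; under [X in expectation _ X]eq_fun do rewrite coordE.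
rewrite fine_expectation_linear_comb; last exact: momP.1.
by apply: eq_bigr => k _; rewrite mxE.
Qed.

Lemma second_moment_mulmx : second_moment P' = C *m second_moment P *m C^T.
Proof.
apply/matrixP => i j; rewrite mxE.
rewrite (expectation_distribution P (mulmx_borel C) (measurable_coordM i j)).
rewrite /mulmx_borel/=; under [X in expectation _ X]eq_fun do rewrite coord2E.
rewrite (fine_expectation_linear_comb _ (g := coordM)); last first.
  by move=> kl; exact: momP.2.
rewrite mxE; under [RHS]eq_bigr do rewrite mxE big_distrl/=.
rewrite exchange_big pair_big/=; apply: eq_bigr => kl _; rewrite !mxE.
by rewrite mulrAC.
Qed.

End ImageMoments.

(** * Comparison of reduced problems *)

Section ReducedValue.
Context {R : realType}.
Variables (n m : nat) (gamma1 gamma2 : R).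
Hypothesis gamma2_ge0 : 0 <= gamma2.
Variables (mu : 'cV[R]_m) (U : 'M[R]_m) (lam : 'rV[R]_m).
Variables (S : set 'cV[R]_m) (X : set 'cV[R]_n).
Variable f : 'cV[R]_n -> 'cV[R]_m -> R.
Hypothesis mf : forall x, measurable_fun setT (f x : borel_cV R m -> R).

(** The mean constraint is preserved with equality, since [C^T *m C = 1%:M];
the second-moment constraint is [loewner_le_conj]. *)
Lemma ambiguity_mulmx p d (C : 'M[R]_(p, d)) (S' : set 'cV[R]_p)
    (P : probability (borel_cV R d) R) :
  orthonormal_cols C ->
  ambiguity gamma1 gamma2 ([eta mulmx C] @^-1` S') P ->
  ambiguity gamma1 gamma2 S' (distribution P (mulmx_borel C)).
Proof.
move=> oC [PS momP meanP covP]; split => //.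
- exact: has_moments_mulmx.
- by rewrite mean_mulmx// trmx_mul mulmxA -(mulmxA _ C^T) oC mulmx1.
- by rewrite second_moment_mulmx//; exact: loewner_le_conj.
Qed.

Lemma reduced_map_mulmx d e (B : 'M[R]_(m, e)) (C : 'M[R]_(e, d)) xi :
  reduced_map mu U lam B (C *m xi) = reduced_map mu U lam (B *m C) xi.
Proof. by rewrite /reduced_map !mulmxA. Qed.

Lemma measurable_reduced_map d (B : 'M[R]_(m, d)) :
  measurable_fun setT (reduced_map mu U lam B : borel_cV R d -> borel_cV R m).
Proof.
apply: continuous_borel_measurable => xi.
apply: (@continuousD _ _ _ (fun v : 'cV[R]_d => scale_mx U lam *m B *m v)
  (fun=> mu)); last exact: cst_continuous.
exact: mulmx_continuous.
Qed.

(** The quantity that [ThetaL] maximises over [B]: the min-max value of the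
problem reduced by a fixed [B]. *)
Definition reduced_value d (B : 'M[R]_(m, d)) : \bar R :=
  ereal_inf [set ereal_sup
    [set ('E_P[fun xi : 'cV[R]_d => f x (reduced_map mu U lam B xi)])%E
    | P in DL gamma1 gamma2 mu U lam S B] | x in X].

(** For each [x], every expectation attainable with [B *m C] is attainable with
[B], by transporting the distribution along [C]. *)
Lemma reduced_value_mulmx d e (B : 'M[R]_(m, e)) (C : 'M[R]_(e, d)) :
  orthonormal_cols C -> (reduced_value (B *m C) <= reduced_value B)%E.
Proof.
move=> oC; apply: le_ereal_inf_tmp => _ [x Xx <-].
apply: le_trans (ereal_inf_lbound _) _; first by exists x.
apply: ereal_sup_le => _ [P DP <-].
exists (distribution P (mulmx_borel C)).
  apply: ambiguity_mulmx => //; move: DP; rewrite /DL/=.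
  congr (ambiguity _ _ _ _); apply/funext => xi.
  by rewrite /preimage/mkset/= reduced_map_mulmx.
rewrite expectation_distribution.
  rewrite /mulmx_borel/=.
  by under [in LHS]eq_fun do rewrite reduced_map_mulmx.
exact: measurableT_comp (mf x) (measurable_reduced_map B).
Qed.

Lemma ThetaM_reduced_value :
  ThetaM gamma1 gamma2 mu U lam S X f = reduced_value (1%:M : 'M[R]_m).
Proof.
have E : reduced_map mu U lam 1%:M = full_map mu U lam.
  by apply/funext => xi; rewrite /reduced_map mulmx1.
by rewrite /reduced_value /DL E.
Qed.

End ReducedValue.

Theorem theorem1 (R : realType) (m n l K : nat)
    (hm : (0 < m)%N) (hn : (0 < n)%N) (hl : (0 < l)%N)
    (gamma1 gamma2 : R) (hgamma1 : 0 <= gamma1) (hgamma2 : 1 <= gamma2)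
    (mu : 'cV[R]_m) (Sigma U : 'M[R]_m) (lam : 'rV[R]_m)
    (hSigma : posdefmx Sigma)
    (hU : U^T *m U = 1%:M)
    (hlam : forall i j : 'I_m, (i <= j)%N -> lam 0 j <= lam 0 i)
    (hdec : Sigma = U *m diag_mx lam *m U^T)
    (X : set 'cV[R]_n)
    (A : 'M[R]_(l, m)) (b : 'cV[R]_l)
    (hS : interior (polyhedron A b) !=set0)
    (y0 : 'I_K.+1 -> 'cV[R]_n -> R) (y : 'I_K.+1 -> 'cV[R]_n -> 'cV[R]_m)
    (hy0 : forall k, is_affine (y0 k : 'cV[R]_n -> R^o))
    (hy : forall k, is_affine (y k)) :
  let S := polyhedron A b in
  let f := max_affine y0 y in
  let Theta_L := ThetaL gamma1 gamma2 mu U lam S X f in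
  let Theta_M := ThetaM gamma1 gamma2 mu U lam S X f in
  [/\ forall m1 : nat, (0 < m1)%N -> (m1 <= m)%N ->
        (Theta_L m1 <= Theta_M)%E,
      forall m1 m2 : nat, (0 < m1)%N -> (m1 < m2)%N -> (m2 <= m)%N ->
        (Theta_L m1 <= Theta_L m2)%E
    & Theta_L m = Theta_M].
Proof.
move=> S f Theta_L Theta_M.
have mf x : measurable_fun setT (f x : borel_cV R m -> R).
  exact: measurable_max_affine.
have gamma2_ge0 : 0 <= gamma2 := le_trans ler01 hgamma2.
have mono d e (B : 'M[R]_(m, e)) (C : 'M[R]_(e, d)) (oC : orthonormal_cols C) :=
  reduced_value_mulmx gamma1 gamma2_ge0 mu U lam S X mf B oC.
have leM m1 : (Theta_L m1 <= Theta_M)%E.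
  apply: ge_ereal_sup => _ [B oB <-]; rewrite /Theta_M ThetaM_reduced_value.
  by have := mono _ _ 1%:M B oB; rewrite mul1mx.
split=> [m1 _ _|m1 m2 _ m12 m2m|]; first exact: leM.
  apply: ge_ereal_sup => _ [B oB <-].
  have m12m : (m1 <= m2 <= m)%N by rewrite (ltnW m12).
  have [B' [C [oB' oC ->]]] := orthonormal_cols_extension oB m12m.
  apply: le_trans (mono _ _ B' C oC) _.
  by apply: ereal_sup_ubound; exists B'.
apply/eqP; rewrite eq_le leM /= /Theta_M ThetaM_reduced_value.
apply: ereal_sup_ubound; exists 1%:M => //.
by rewrite /orthonormal_cols/= trmx1 mulmx1.
Qed.
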